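(* For every integer $n\ge1$ and $m\ge0$, \[ \mathcal{B}_{n,m}^{(k)}(a,q,L)=(-1)^n\sum_{j=1}^{n}\sum_{i=1}^{n}q^{n-j}\,i!\left\{ {n \atop i} \right\}\left\{ {i \atop j} \right\}\widehat{\mathcal{C}}_{j,m}^{(k)}(a,q,L). \]
   Context: Let $k\ge1$ be an integer, $a,q,l_1,\dots,l_k$ nonzero reals, $l=\prod l_i$, $L=(l_1,\dots,l_k)$; denominators $a+j$ ($j\ge0$ integer) assumed nonzero and $l^{a+i}$ means $l^al^i$. Let $s(n,i)$ be the signed Stirling numbers of the first kind ($\frac{1}{i!}(\ln(1+x))^i=\sum_{n\ge i}s(n,i)\frac{x^n}{n!}$) and $\left\{ {n \atop i} \right\}$ the Stirling numbers of the second kind. Define \[ \widehat{\mathcal{C}}_{n,m}^{(k)}(a,q,L)=\frac{(a+m)^k}{a^k}\sum_{i=0}^{n}s(n,i)\frac{(-1)^iq^{n-i}l^{a+i}}{(a+i+m)^k},\qquad \mathcal{B}_{n,m}^{(k)}(a,q,L)=\frac{(a+m)^k}{a^k}\sum_{i=0}^{n}\frac{i!(-q)^{n-i}l^{i+a}}{(a+m+i)^k}\left\{ {n \atop i} \right\}. \] *)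

(* Defs.v *)
From mathcomp Require Import all_boot all_order all_algebra.
From mathcomp Require Import complex.
From mathcomp Require Import reals exp trigo.

Set Implicit Arguments.
Unset Strict Implicit.
Unset Printing Implicit Defensive.

Import Order.TTheory GRing.Theory Num.Theory.
Local Open Scope ring_scope.
Local Open Scope complex_scope.

(* A formal power series over [rat] is its sequence of coefficients. *)
Definition fps_one : nat -> rat := fun n => (n == 0%N)%:R.

Definition fps_mul (f g : nat -> rat) : nat -> rat :=
  fun n => \sum_(j < n.+1) f j * g (n - j)%N.

Definition fps_exp (f : nat -> rat) (i : nat) : nat -> rat :=
  iter i (fps_mul f) fps_one.

(* ln(1 + x) = \sum_(r >= 1) (-1)^(r - 1) x^r / r *)
Definition fps_log1p : nat -> rat :=
  fun r => if r == 0%N then 0 else (-1) ^+ r.-1 / r%:R.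

(* n! times the coefficient of x^n in (ln(1 + x))^i / i! *)
Definition stirling1 (n i : nat) : rat :=
  n`!%:R * (fps_exp fps_log1p i n / i`!%:R).

Definition stirling2 (n i : nat) : nat :=
  #|[set P : {set {set 'I_n}} | partition P [set: 'I_n] & #|P| == i]|.

(* Principal value exp (a Log x) of x^a for real x != 0 and real a, where
   Log x = ln |x| + i pi when x < 0; for x > 0 it is the real power. *)
Definition cpowR (R : realType) (x a : R) : R[i] :=
  (`|x| `^ a)%:C * (if x < 0 then cos (a * pi) +i* sin (a * pi) else 1).

Section PolyNumbers.
Variables (R : realType) (k : nat) (a q : R) (L : 'I_k -> R).

Let l : R := \prod_(i < k) L i.

Definition polyCauchyHat (n m : nat) : R[i] :=
  (a + m%:R)%:C ^+ k / a%:C ^+ k *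
  \sum_(i < n.+1)
     ratr (stirling1 n i) *
     ((-1) ^+ i * q%:C ^+ (n - i) * (cpowR l a * l%:C ^+ i)
        / (a + i%:R + m%:R)%:C ^+ k).

Definition polyBernoulli (n m : nat) : R[i] :=
  (a + m%:R)%:C ^+ k / a%:C ^+ k *
  \sum_(i < n.+1)
     (i`!%:R * (- q%:C) ^+ (n - i) * (cpowR l a * l%:C ^+ i)
        / (a + m%:R + i%:R)%:C ^+ k) *
     (stirling2 n i)%:R.

End PolyNumbers.

(* Main.v *)
Require Import Defs.
From mathcomp Require Import all_boot all_order all_algebra.
From mathcomp Require Import complex.
From mathcomp Require Import reals exp trigo.
From mathcomp Require Import ring.

Import Order.TTheory GRing.Theory Num.Theory.
Local Open Scope ring_scope.
Local Open Scope complex_scope.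

(** The identity is the inversion formula
    [\sum_j S(i, j) s(j, p) = (i == p)] applied to the definition of the
    poly-Cauchy numbers.  Sorting the functions from an [n]-set to an [x]-set by
    their kernel partition gives [x ^ n = \sum_j S(n, j) x ^_ j].  The derivation
    [(1 + x) d/dx] sends [ln (1 + x)] to [1], which gives the recurrence of the
    [s(n, i)] and hence [x ^_ n = \sum_i s(n, i) x ^ i].  The two expansions
    compose to a polynomial identity valid at every natural number. *)

(** Maps with kernel partition [P] are exactly the injective maps on the blocks of [P], precomposed
    with the quotient map [h]; [phi] is this precomposition. *)
Lemma card_ffun_preim_partition (T rT : finType) (P : {set {set T}}) :
  partition P [set: T] ->
  #|[set f : {ffun T -> rT} | preim_partition f [set: T] == P]|
    = (#|rT| ^_ #|P|)%N.
Proof.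
move=> partP; have [/eqP covP tiP nP0] := and3P partP.
have inP x : pblock P x \in P by apply: pblock_mem; rewrite covP inE.
pose h x : {B | B \in P} := exist _ (pblock P x) (inP x).
have h_surj (B : {B | B \in P}) : exists x, h x == B.
  case: B => B BP; have /set0Pn[x xB] : B != set0.
    by apply: contraNneq nP0 => <-.
  by exists x; apply/eqP/val_inj; exact: def_pblock.
have eq_h x y : (h x == h y) = (y \in pblock P x).
  by rewrite -eq_pblock // covP inE.
pose phi (g : {ffun {B | B \in P} -> rT}) : {ffun T -> rT} := [ffun x => g (h x)].
have phi_inj : injective phi.
  move=> g1 g2 /ffunP eq_g; apply/ffunP => B.
  by have [x /eqP <-] := h_surj B; have := eq_g x; rewrite !ffunE.
rewrite -[#|P|]card_sig -card_inj_ffuns -(card_imset _ phi_inj).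
apply: eq_card => f; rewrite inE; apply/eqP/imsetP => [defP | [g]].
- have ker x y : (h x == h y) = (f x == f y).
    rewrite eq_h -defP pblock_equivalence_partition ?inE //.
    by move=> u v w _ _ _; split=> // /eqP->.
  (* [g] evaluates [f] at a chosen representative of each block; by [ker] the choice does not
     matter. *)
  pose g := [ffun B => f (xchoose (h_surj B))].
  have gh x : g (h x) = f x.
    by rewrite ffunE; apply/eqP; rewrite -ker; exact: (xchooseP (h_surj (h x))).
  exists g; last by apply/ffunP => x; rewrite ffunE gh.
  rewrite inE; apply/injectiveP => B1 B2.
  have [x /eqP <-] := h_surj B1; have [y /eqP <-] := h_surj B2.
  by rewrite !gh => /eqP; rewrite -ker => /eqP.
- rewrite inE => /injectiveP g_inj ->.
  rewrite -[RHS](equivalence_partition_pblock partP).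
  apply: eq_imset => x; apply/setP => y.
  by rewrite !inE /= !ffunE (inj_eq g_inj) eq_h.
Qed.

(** A transversal lies inside [D] and has one element per block. *)
Lemma leq_card_partition (T : finType) (P : {set {set T}}) (D : {set T}) :
  partition P D -> (#|P| <= #|D|)%N.
Proof.
move=> partP; have trP := transversalP partP.
rewrite -(card_transversal trP); apply: subset_leq_card.
exact: transversal_sub trP.
Qed.

(** The bound [N] is separate from [n] so that the inversion can use one range of summation for all
    rows [n <= N]. *)
Lemma expn_stirling2 (N n x : nat) : (n <= N)%N ->
  (x ^ n = \sum_(j < N.+1) stirling2 n j * x ^_ j)%N.
Proof.
move=> le_nN; rewrite -[x in LHS]card_ord -[n in LHS]card_ord -card_ffun.
rewrite -sum1_card.
rewrite (partition_big (fun f : {ffun 'I_n -> 'I_x} => preim_partition f [set: 'I_n])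
  (fun P => partition P [set: 'I_n])) /=; last by move=> f _; exact: preim_partitionP.
rewrite (eq_bigr (fun P : {set {set 'I_n}} => x ^_ #|P|)%N); last first.
  by move=> P partP; rewrite sum1dep_card card_ffun_preim_partition // card_ord.
(* Group the partitions by number of blocks. That number is at most [n <= N], so [inord] never falls
   back to its default value. *)
rewrite (partition_big (fun P : {set {set 'I_n}} => inord #|P| : 'I_N.+1) predT) //=.
apply: eq_bigr => j _; rewrite /stirling2 -sum_nat_const.
have inordE (P : {set {set 'I_n}}) : partition P [set: 'I_n] ->
    (inord #|P| == j) = (#|P| == j).
  move=> /leq_card_partition; rewrite cardsT card_ord => leP.
  by rewrite -val_eqE /= inordK // ltnS (leq_trans leP).
apply: eq_big => [P | P /andP[partP]].
  by rewrite !inE; case partP: (partition _ _) => //=; rewrite inordE.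
by rewrite inordE // => /eqP->.
Qed.

(** At [x = 0] the expansion of [0 ^ n = 0] contains the term [stirling2 n 0 * 0 ^_ 0], and a sum of
    naturals vanishes only termwise. *)
Lemma stirling2n0 (n : nat) : (0 < n)%N -> stirling2 n 0 = 0%N.
Proof.
by move=> n0; have := @expn_stirling2 n n 0 (leqnn n);
  rewrite exp0n // big_ord_recl ffactn0 muln1; case: stirling2.
Qed.

(* The coefficients of [(1 + x) f'(x)]. *)
Definition fps_deriv1p (f : nat -> rat) : nat -> rat :=
  fun n => n.+1%:R * f n.+1 + n%:R * f n.

(** Leibniz rule: writing the degree as [j + (n - j)] splits the Euler part [x d/dx] ([low]), and
    the same split in degree [n.+1] handles [d/dx] ([high]). *)
Lemma fps_deriv1pM (f g : nat -> rat) (n : nat) :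
  fps_deriv1p (fps_mul f g) n =
  fps_mul (fps_deriv1p f) g n + fps_mul f (fps_deriv1p g) n.
Proof.
have low : n%:R * fps_mul f g n =
    \sum_(j < n.+1) j%:R * f j * g (n - j)%N +
    \sum_(j < n.+1) f j * ((n - j)%N%:R * g (n - j)%N).
  rewrite /fps_mul mulr_sumr -big_split; apply: eq_bigr => j _ /=.
  by rewrite natrB; [ring | rewrite -ltnS].
have high : n.+1%:R * fps_mul f g n.+1 =
    \sum_(j < n.+1) j.+1%:R * f j.+1 * g (n - j)%N +
    \sum_(j < n.+1) f j * ((n - j).+1%:R * g (n - j).+1).
  have -> : n.+1%:R * fps_mul f g n.+1 =
      \sum_(j < n.+2) j%:R * f j * g (n.+1 - j)%N +
      \sum_(j < n.+2) f j * ((n.+1 - j)%N%:R * g (n.+1 - j)%N).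
    rewrite /fps_mul mulr_sumr -big_split; apply: eq_bigr => j _ /=.
    by rewrite natrB; [ring | rewrite -ltnS].
  (* The first sum loses its term [j = 0] and the second its term [j = n.+1], both with a zero
     factor. *)
  rewrite big_ord_recl !mul0r add0r; congr (_ + _).
  rewrite big_ord_recr /= subnn mul0r mulr0 addr0.
  by apply: eq_bigr => j _; rewrite subSn // -ltnS.
rewrite /fps_deriv1p low high /fps_mul /fps_deriv1p addrACA -!big_split /=.
by apply: eq_bigr => j _ /=; ring.
Qed.

Lemma fps_deriv1p_log1p (n : nat) : fps_deriv1p fps_log1p n = fps_one n.
Proof.
rewrite /fps_deriv1p /fps_log1p /fps_one; case: n => [|n] /=; first by field.
have n1 : n.+1%:R != 0 :> rat by rewrite pnatr_eq0.
have n2 : n.+2%:R != 0 :> rat by rewrite pnatr_eq0.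
by rewrite exprS mulrCA divff // mulrCA divff //; ring.
Qed.

Lemma eq_fps_mul (f f' g g' : nat -> rat) :
  f =1 f' -> g =1 g' -> fps_mul f g =1 fps_mul f' g'.
Proof. by move=> ef eg n; apply: eq_bigr => j _; rewrite ef eg. Qed.

Lemma fps_mul1 (f : nat -> rat) : fps_mul fps_one f =1 f.
Proof.
move=> n; rewrite /fps_mul big_ord_recl /fps_one mul1r subn0 big1 ?addr0 //.
by move=> j _; rewrite mul0r.
Qed.

(** Power rule, by induction from the Leibniz rule, since the derivation sends [ln (1 + x)] to 1. *)
Lemma fps_deriv1p_log1pX (i n : nat) :
  fps_deriv1p (fps_exp fps_log1p i.+1) n = i.+1%:R * fps_exp fps_log1p i n.
Proof.
elim: i n => [|i IHi] n; rewrite [fps_exp _ _.+1]/= fps_deriv1pM;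
  rewrite (eq_fps_mul _ _ _ _ fps_deriv1p_log1p (frefl _)) fps_mul1.
  rewrite mul1r /fps_mul big1 ?addr0 // => j _.
  rewrite /fps_deriv1p /= /fps_one /= mulr0 add0r.
  by case: (n - j)%N => [|r]; rewrite ?mul0r !mulr0.
rewrite (eq_fps_mul _ _ _ _ (frefl _) IHi).
have -> : fps_mul fps_log1p (fun r => i.+1%:R * fps_exp fps_log1p i r) n =
    i.+1%:R * fps_exp fps_log1p i.+1 n.
  by rewrite /= {1}/fps_mul mulr_sumr; apply: eq_bigr => j _; rewrite mulrCA.
by rewrite -[i.+2%:R]natr1 addrC mulrDl mul1r.
Qed.

Lemma stirling1n0 (n : nat) : stirling1 n 0 = (n == 0%N)%:R.
Proof.
by rewrite /stirling1 /= /fps_one divr1; case: n => [|n]; rewrite ?mulr0.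
Qed.

Lemma stirling10S (i : nat) : stirling1 0 i.+1 = 0.
Proof. by rewrite /stirling1 /= {1}/fps_mul big_ord1 !mul0r mulr0. Qed.

(** Compare coefficients of [x ^ n] in the power rule and rescale by the factorials. *)
Lemma stirling1SS (n i : nat) :
  stirling1 n.+1 i.+1 = stirling1 n i - n%:R * stirling1 n i.+1.
Proof.
have := fps_deriv1p_log1pX i n; rewrite /fps_deriv1p => /(canRL (addrK _)) E.
rewrite /stirling1 !factS !natrM [i.+1%:R * i`!%:R]mulrC.
have i1 : i.+1%:R != 0 :> rat by rewrite pnatr_eq0.
have i2 : i`!%:R != 0 :> rat by rewrite pnatr_eq0 -lt0n fact_gt0.
rewrite [n.+1%:R * n`!%:R]mulrC -mulrA [n.+1%:R * (_ / _)]mulrA E.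
by field; rewrite nat1r i1 i2.
Qed.

Lemma stirling1_small (n i : nat) : (n < i)%N -> stirling1 n i = 0.
Proof.
elim: n i => [|n IHn] [|i] // lt_ni; first exact: stirling10S.
by rewrite stirling1SS !IHn ?mulr0 ?subr0 // ltnW.
Qed.

Definition stirling1_poly (n : nat) : {poly rat} :=
  \poly_(i < n.+1) stirling1 n i.

Lemma coef_stirling1_poly (n i : nat) : (stirling1_poly n)`_i = stirling1 n i.
Proof. by rewrite coef_poly ltnS; case: leqP => // /stirling1_small. Qed.

(** Iterating this gives [X (X - 1) ... (X - n + 1)], the falling factorial. *)
Lemma stirling1_polyS (n : nat) :
  stirling1_poly n.+1 = stirling1_poly n * ('X - n%:R%:P).
Proof.
apply/polyP => i; rewrite mulrBr coefB coefMX coefMC !coef_stirling1_poly.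
case: i => [|i] /=; last by rewrite stirling1SS [_ * n%:R]mulrC.
by rewrite !stirling1n0 sub0r; case: n => [|n]; rewrite ?mulr0 ?mul0r oppr0.
Qed.

Lemma horner_stirling1_poly (n x : nat) :
  (stirling1_poly n).[x%:R] = (x ^_ n)%:R.
Proof.
elim: n => [|n IHn].
  by rewrite /stirling1_poly horner_poly big_ord1 stirling1n0 mulr1.
rewrite stirling1_polyS hornerM IHn !hornerE ffactnSr natrM.
(* For [x < n] the natural subtraction truncates, but [x ^_ n] is already 0. *)
have [le_nx|lt_xn] := leqP n x; first by rewrite natrB.
by rewrite ffact_small // !mul0r.
Qed.

Lemma stirling2_stirling1_poly (N n : nat) : (n <= N)%N ->
  \sum_(j < N.+1) (stirling2 n j)%:R *: stirling1_poly j = 'X^n.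
Proof.
move=> le_nN; apply/eqP; rewrite -subr_eq0; apply/eqP.
(* The difference vanishes at [size p] distinct naturals, too many for a nonzero polynomial. *)
set p := _ - _; pose rs : seq rat := [seq x%:R | x <- iota 0 (size p)].
apply: (@roots_geq_poly_eq0 _ p rs); last by rewrite size_map size_iota.
  apply/allP => _ /mapP[x _ ->]; rewrite /root /p hornerD hornerN hornerXn.
  rewrite horner_sum -natrX (expn_stirling2 N) // natr_sum subr_eq0.
  by apply/eqP/eq_bigr => j _; rewrite hornerZ horner_stirling1_poly natrM.
rewrite map_inj_uniq ?iota_uniq // => x y /eqP.
by rewrite eqr_nat => /eqP.
Qed.

Lemma stirling2_stirling1_orthogonal (N n p : nat) : (n <= N)%N ->
  \sum_(j < N.+1) (stirling2 n j)%:R * stirling1 j p = (p == n)%:R.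
Proof.
move=> le_nN; rewrite -coefXn -(stirling2_stirling1_poly N) // coef_sum.
by apply: eq_bigr => j _; rewrite coefZ coef_stirling1_poly.
Qed.

(** For each fixed [i], summing over [j] first turns the Stirling products into a Kronecker delta,
    leaving only [p = i]. The weights [y] can be arbitrary. *)
Lemma stirling_transform_inversion (F : numFieldType) (q : F) (y : nat -> F)
    (n : nat) : (0 < n)%N ->
  \sum_(i < n.+1) i`!%:R * (- q) ^+ (n - i) * y i * (stirling2 n i)%:R =
  (-1) ^+ n * \sum_(1 <= j < n.+1) \sum_(1 <= i < n.+1)
     q ^+ (n - j) * i`!%:R * (stirling2 n i)%:R * (stirling2 i j)%:R *
     \sum_(p < j.+1) ratr (stirling1 j p) * ((-1) ^+ p * q ^+ (j - p) * y p).
Proof.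
move=> n_gt0.
(* Since [q ^+ (n - j) * q ^+ (j - p) = q ^+ (n - p)], the summand [z p] is free of [j]; [widen]
   also extends the range of [p] to [n], as [stirling1 j p = 0] for [p > j]. *)
pose z p := (-1) ^+ p * q ^+ (n - p) * y p.
have widen j : (j < n.+1)%N -> q ^+ (n - j) *
    (\sum_(p < j.+1) ratr (stirling1 j p) * ((-1) ^+ p * q ^+ (j - p) * y p)) =
    \sum_(p < n.+1) ratr (stirling1 j p) * z p.
  move=> lt_jn; rewrite mulr_sumr.
  rewrite [RHS](bigID (fun p : 'I_n.+1 => p < j.+1)%N) /= [X in _ + X]big1 ?addr0.
    rewrite (big_ord_widen n.+1 (fun p => q ^+ (n - j) *
      (ratr (stirling1 j p) * ((-1) ^+ p * q ^+ (j - p) * y p)))) //.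
    apply: eq_bigr => p; rewrite ltnS => le_pj.
    have -> : z p = (-1) ^+ p * (q ^+ (n - j) * q ^+ (j - p)) * y p.
      by rewrite /z -exprD addnBA // subnK.
    by ring.
  by move=> p; rewrite -leqNgt => lt_jp; rewrite stirling1_small // rmorph0 mul0r.
have orth i p : (i < n.+1)%N ->
    \sum_(j < n.+1) (stirling2 i j)%:R * ratr (stirling1 j p) = (p == i)%:R :> F.
  move=> lt_in; rewrite -[RHS](@ratr_nat F) -(stirling2_stirling1_orthogonal n) //.
  by rewrite rmorph_sum; apply: eq_bigr => j _; rewrite rmorphM /= ratr_nat.
(* The left sum loses its term [i = 0], since [stirling2 n 0 = 0] for [n > 0]. *)
rewrite exchange_big big_add1 big_mkord big_ord_recl stirling2n0 // mulr0 add0r.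
rewrite mulr_sumr; apply: eq_bigr => i0 _; pose i : 'I_n.+1 := lift ord0 i0.
rewrite -[lift _ _]/i [i0.+1](_ : _ = i :> nat) //.
have i_gt0 : (0 < i)%N by [].
move: i i_gt0 => {i0} i i_gt0.
transitivity ((-1) ^+ n * (i`!%:R * (stirling2 n i)%:R *
    \sum_(p < n.+1) (\sum_(j < n.+1) (stirling2 i j)%:R * ratr (stirling1 j p)) *
      z p)).
  rewrite (bigD1 i) //= orth // eqxx mul1r big1 ?addr0; last first.
    by move=> p ne_pi; rewrite orth // val_eqE (negbTE ne_pi) mul0r.
  (* [n - i] and [n + i] have the same parity. *)
  have -> : (- q) ^+ (n - i) = (-1) ^+ n * (-1) ^+ i * q ^+ (n - i).
    have le_in : (i <= n)%N by rewrite -ltnS.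
    by rewrite -exprD -signr_odd oddD -(oddB le_in) signr_odd -exprMn mulN1r.
  by rewrite /z; ring.
congr (_ * _).
have -> : \sum_(p < n.+1) (\sum_(j < n.+1) (stirling2 i j)%:R *
      ratr (stirling1 j p)) * z p =
    \sum_(j < n.+1) (stirling2 i j)%:R *
      \sum_(p < n.+1) ratr (stirling1 j p) * z p.
  transitivity (\sum_(p < n.+1) \sum_(j < n.+1)
      (stirling2 i j)%:R * (ratr (stirling1 j p) * z p)).
    apply: eq_bigr => p _; rewrite mulr_suml.
    by apply: eq_bigr => j _; rewrite mulrA.
  by rewrite exchange_big; apply: eq_bigr => j _; rewrite mulr_sumr.
(* Likewise [j = 0] drops out because [i > 0]. *)
rewrite big_ord_recl stirling2n0 // mul0r add0r.
rewrite big_add1 big_mkord mulr_sumr; apply: eq_bigr => j _.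
by rewrite -widen ?ltn_ord //=; ring.
Qed.

Theorem theorem10 (R : realType) (k : nat) (a q : R) (L : 'I_k -> R)
    (k_ge1 : (1 <= k)%N) (a_neq0 : a != 0) (q_neq0 : q != 0)
    (L_neq0 : forall i : 'I_k, L i != 0)
    (den_neq0 : forall j : nat, a + j%:R != 0)
    (n m : nat) (n_ge1 : (1 <= n)%N) :
  polyBernoulli a q L n m =
  (-1) ^+ n *
  \sum_(1 <= j < n.+1) \sum_(1 <= i < n.+1)
     q%:C ^+ (n - j) * i`!%:R * (stirling2 n i)%:R * (stirling2 i j)%:R *
     polyCauchyHat a q L j m.
Proof.
rewrite /polyBernoulli /polyCauchyHat.
set c := (_ / _); set l := \prod_(i < k) L i.
(* [y] collects the powers of [l] and the denominators shared by both families; the prefactor [c] is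
   common and moves through the sums. *)
pose y (p : nat) : R[i] := cpowR l a * l%:C ^+ p / (a + m%:R + p%:R)%:C ^+ k.
under eq_bigr => i _ do rewrite -[_ * _ / _]mulrA -/(y i).
rewrite stirling_transform_inversion // mulrCA; congr (_ * _).
rewrite mulr_sumr; apply: eq_bigr => j _.
rewrite mulr_sumr; apply: eq_bigr => i _.
rewrite mulrCA; congr (_ * (_ * _)); apply: eq_bigr => p _.
by rewrite [a + p%:R + m%:R]addrAC -[_ / _ in RHS]mulrA.
Qed.
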